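(* Let $d\ge2$, $p\in[1,\infty)$ and $f\in W^{1,\infty}(\mathbb{R}^d)$ real-valued. Set $\lambda_n=\frac{11}{8}2^n$ and $t_n=\frac{8}{11}\pi n2^{-n}$. Then there is $N_0\in\mathbb{N}^+$ such that for all sufficiently large $n$, $$\big\|\cos\big(\lambda_n(x_1-t_nf(x))\big)\big\|_{L^p([0,2\pi2^{-N_0}]^d)}\ge 2^{-\frac dpN_0-2},$$ where $x=(x_1,\dots,x_d)$. *)

(* Defs.v *)
From HB Require Import structures.
From mathcomp Require Import all_boot all_order all_algebra.
From mathcomp Require Import all_classical all_reals all_analysis.
Set Implicit Arguments. Unset Strict Implicit. Unset Printing Implicit Defensive.
Import Order.TTheory GRing.Theory Num.Theory.
Import numFieldNormedType.Exports.
Local Open Scope classical_set_scope.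
Local Open Scope ring_scope.

(* A point of R^d is represented, for integration purposes, by its coordinate
   function x : nat -> R (coordinates 0..d-1 are used; x 0 is the paper's x_1). *)
Definition vec {R : realType} (d : nat) (x : nat -> R) : 'rV[R]_d :=
  \row_(i < d) x i.

(* Iterated Lebesgue integral over the cube [a,b]^k of g, integrating
   coordinates 0, ..., k-1 (other coordinates set to 0). *)
Fixpoint cube_int {R : realType} (k : nat) (a b : R)
    (g : (nat -> R) -> \bar R) : \bar R :=
  match k with
  | 0 => g (fun _ => 0)
  | k'.+1 =>
      (\int[@lebesgue_measure R]_(t in `[a, b]) 
          cube_int k' a b (fun x => g (fun i => if i == k' then t else x i)))%E
  end.

Definition Lp_norm_cube {R : realType} (d : nat) (p L : R)
    (g : (nat -> R) -> R) : \bar R :=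
  ((cube_int d 0 L (fun x => ((`|g x|) `^ p)%:E)) `^ p^-1)%E.

(* W^{1,oo}(R^d), real valued: (the continuous representative is) bounded and
   Lipschitz. *)
Definition W1inf {R : realType} (d : nat) (f : 'rV[R]_d -> R) : Prop :=
  (exists M : R, forall x, `|f x| <= M) /\
  (exists K : R, forall x y, `|f x - f y| <= K * `|x - y|).

Definition lambda_seq {R : realType} (n : nat) : R := (11 / 8) * 2 ^+ n.
Definition t_seq {R : realType} (n : nat) : R := (8 / 11) * pi * n%:R / 2 ^+ n.

(* Main.v *)
Require Import Defs.
From HB Require Import structures.
From mathcomp Require Import all_boot all_order all_algebra.
From mathcomp Require Import all_classical all_reals all_analysis.
From mathcomp Require Import measurable_realfun ring lra zify.

(* Freeze all coordinates but the first: g t := f (t, x_2, ..., x_d) is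
   K-Lipschitz, and the phase th t := lambda_n (t - t_n g t) satisfies
   th (t + s) = th t + pi/2 + e for the quarter period s := pi / (2 lambda_n),
   with |e| <= t_n K pi / 2, which is small since t_n ~ n 2^-n.  As
   |cos (th t + pi/2 + e)| = |sin (th t + e)|, one of |cos (th t)| and
   |cos (th (t + s))| is at least 1/2, so h := |cos o th|^p satisfies
   h t + h (t + s) >= 2^-p.  Integrating over [0, pi] and comparing the
   integral of h (. + s) with that of h by translation invariance gives
   int_0^pi h >= (2^-p pi - s) / 2 >= 2^-p pi / 4 as soon as s <= 2^-p pi / 2.
   Integrating this slice bound over the other coordinates of [0, pi]^d
   (that is, N0 = 1) yields the L^p bound. *)

Set Implicit Arguments. Unset Strict Implicit. Unset Printing Implicit Defensive.
Import Order.TTheory GRing.Theory Num.Theory.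
Import numFieldNormedType.Exports.
Local Open Scope ring_scope.

Lemma leq_sqr_exp2 (n : nat) : (4 <= n)%N -> (n * n <= 2 ^ n)%N.
Proof.
elim: n => [//|n IH]; rewrite leq_eqVlt => /orP[/eqP <-//|].
rewrite ltnS => n4; rewrite expnS (leq_trans _ (leq_mul (leqnn 2) (IH n4))) //.
nia.
Qed.

Section real_functions.
Context {R : realType}.

Lemma powRV (a p : R) : 0 < a -> a^-1 `^ p = (a `^ p)^-1.
Proof.
move=> a0; apply: (@mulIf _ (a `^ p)); first by rewrite gt_eqF // powR_gt0.
rewrite -powRM ?invr_ge0 ?(ltW a0) // mulVf ?gt_eqF // powR1.
by rewrite mulVf // gt_eqF // powR_gt0.
Qed.

Lemma pi_le4 : pi <= 4 :> R.
Proof. by have := @pihalf_lt2 R; rewrite ltr_pdivrMr //; lra. Qed.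

Lemma lipschitz_continuous (V W : normedModType R) (f : V -> W) (K : R) :
  0 < K -> (forall x y, `|f x - f y| <= K * `|x - y|) -> continuous f.
Proof.
move=> K0 f_lip x; apply/cvgrPdist_lt => e e0; near=> z.
rewrite (le_lt_trans (f_lip x z)) // -ltr_pdivlMl //.
by near: z; apply: cvgr_dist_lt; rewrite // mulrC divr_gt0.
Unshelve. all: by end_near. Qed.

Lemma ler_dist_sin (x y : R) : `|sin x - sin y| <= `|x - y|.
Proof.
wlog xy : x y / x < y.
  move=> W; have [xy|yx|->] := ltgtP x y; first exact: W.
    by rewrite distrC [`|x - y|]distrC; exact: W.
  by rewrite !subrr normr0.
have [c _ sin_mvt] := MVT xy (fun c _ => is_derive_sin c)
  (continuous_subspaceT (@continuous_sin R)).
by rewrite distrC [`|x - y|]distrC sin_mvt normrM ler_piMl // cos_max.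
Qed.

Lemma ler_dist_cos (x y : R) : `|cos x - cos y| <= `|x - y|.
Proof.
rewrite -!sinDpihalf; apply: le_trans (ler_dist_sin _ _) _.
by rewrite opprD addrACA subrr addr0.
Qed.

(* |cos t| <= 1/2 forces |sin t| >= sqrt 3 / 2 > 1/2 + 3/10. *)
Lemma norm_cos_or_sin_ge_half (t e : R) : `|e| <= 3 / 10 ->
  2^-1 <= `|cos t| \/ 2^-1 <= `|sin (t + e)|.
Proof.
move=> e_small; have [cos_large|cos_small] := orP (le_total 2^-1 `|cos t|); first by left.
right; have := ler_dist_sin (t + e) t; rewrite addrAC subrr add0r => sin_close.
have := cos2Dsin2 t; move: cos_small; rewrite ler_norml => /andP[c1 c2].
move: (le_trans sin_close e_small); rewrite ler_norml => /andP[s1 s2].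
move: e_small; rewrite ler_norml => /andP[e1 e2].
move=> pythagoras; rewrite ler_normr; apply/orP; have [s0|s0] := lerP 0 (sin t); [left|right]; nra.
Qed.

Lemma powR_norm_cos_quarter_turn_ge (p t e : R) : 0 <= p -> `|e| <= 3 / 10 ->
  2^-1 `^ p <= `|cos t| `^ p + `|cos (t + pi / 2 + e)| `^ p.
Proof.
move=> p0 e_small.
have powR_half_le u : 2^-1 <= u -> 2^-1 `^ p <= u `^ p.
  by move=> u_ge; apply: ge0_ler_powR; rewrite ?nnegrE ?(le_trans _ u_ge).
rewrite -addrA (addrC (pi / 2)) addrA cosDpihalf normrN.
case: (@norm_cos_or_sin_ge_half t e e_small) => /powR_half_le/le_trans; apply.
  by rewrite lerDl powR_ge0.
by rewrite lerDr powR_ge0.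
Qed.

End real_functions.

Section lebesgue_integral_itv.
Local Open Scope classical_set_scope.
Local Open Scope ereal_scope.
Context {R : realType}.
Local Notation mu := (@lebesgue_measure R).

Let measurable_addr (s : R) : measurable_fun [set: R] (+%R ^~ s).
Proof. exact: measurable_funD. Qed.

Lemma lebesgue_measure_addr (s : R) (A : set R) : measurable A ->
  pushforward mu (+%R ^~ s : R -> measurableTypeR R) A = mu A.
Proof.
move=> mA; apply/esym/lebesgue_measure_unique => //; first exact: measurable_addr.
move=> ms _ [[a b]] _ <-.
transitivity (mu ((+%R ^~ s) @^-1` `]a, b]%classic)) => //.
rewrite (_ : _ @^-1` _ = `](a - s)%R, (b - s)%R]%classic); last first.
  by apply/seteqP; split => x /=; rewrite !in_itv/= lerBrDr ltrBlDr.
rewrite !lebesgue_measure_itv/= !lte_fin ltrBlDr subrK.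
by case: ifP => // _; rewrite -!EFinB opprB addrA subrK addrC.
Qed.

Lemma ge0_integral_itv_addr (s a b : R) (h : R -> R) :
  measurable_fun [set: R] h -> (forall x, (0 <= h x)%R) ->
  \int[mu]_(x in `[a, b]) (h (x + s))%:E =
  \int[mu]_(x in `[(a + s)%R, (b + s)%R]) (h x)%:E.
Proof.
move=> mh h0.
have -> : `[a, b]%classic = (+%R ^~ s) @^-1` `[(a + s)%R, (b + s)%R]%classic.
  by apply/seteqP; split => x /=; rewrite !in_itv/= !lerD2r.
rewrite -(@ge0_integral_pushforward _ _ (measurableTypeR R) (measurableTypeR R) R
  _ (measurable_addr s) mu _ (EFin \o h)) //; last 2 first.
- exact/measurable_EFinP/measurable_funTS.
- by move=> x _; rewrite /= lee_fin.
apply: eq_measure_integral => [|ms A mA _]; first exact: measurable_addr.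
exact: lebesgue_measure_addr.
Qed.

(* No measurability is assumed: the inner integrals of [cube_int] are not known
   to be measurable in the remaining coordinates. *)
Lemma ge0_le_integral_nonmeasurable (D : set R) (f1 f2 : R -> \bar R) :
  (forall x, D x -> 0 <= f1 x) -> (forall x, D x -> f1 x <= f2 x) ->
  \int[mu]_(x in D) f1 x <= \int[mu]_(x in D) f2 x.
Proof.
move=> f10 f12.
have f20 x : D x -> 0 <= f2 x by move=> Dx; exact: le_trans (f10 x Dx) (f12 x Dx).
rewrite !ge0_integralE //; apply: ereal_sup_le => _ [g /= g_le <-].
exists g => //= x; apply: le_trans (g_le x) _; rewrite /patch.
by case: ifP => // /set_mem; exact: f12.
Qed.

Lemma integral_cst_itv (a b c : R) : (a < b)%R ->
  \int[mu]_(x in `[a, b]) c%:E = (c * (b - a))%:E.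
Proof.
by move=> ab; rewrite integral_cst//= lebesgue_measure_itv/= lte_fin ab -EFinB.
Qed.

End lebesgue_integral_itv.

Section shift_sum_integral.
Local Open Scope classical_set_scope.
Local Open Scope ereal_scope.
Context {R : realType}.
Local Notation mu := (@lebesgue_measure R).
Variables (h : R -> R) (a b s : R).
Hypotheses (mh : measurable_fun [set: R] h) (h01 : forall x, (0 <= h x <= 1)%R).
Hypotheses (ab : (a < b)%R) (s0 : (0 < s)%R).

Let h0 x : (0 <= h x)%R. Proof. by case/andP: (h01 x). Qed.

Let integral_le_measure (A : set R) : measurable A ->
  \int[mu]_(x in A) (h x)%:E <= mu A.
Proof.
move=> mA; rewrite -[X in _ <= X]mul1e -integral_cst //.
apply: ge0_le_integral_nonmeasurable => x _; rewrite lee_fin ?h0 //.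
by case/andP: (h01 x).
Qed.

Lemma integral_itv_addr_le :
  \int[mu]_(x in `[a, b]) (h (x + s))%:E <= \int[mu]_(x in `[a, b]) (h x)%:E + s%:E.
Proof.
have mhE : measurable_fun [set: R] (fun x => (h x)%:E) by exact/measurable_EFinP.
rewrite ge0_integral_itv_addr //.
apply: (@le_trans _ _ (\int[mu]_(x in `[a, (b + s)%R]) (h x)%:E)).
  apply: ge0_subset_integral => //=; first exact: measurable_funTS.
  - by move=> x _; rewrite lee_fin.
  - move=> x /=; rewrite !in_itv/= => /andP[asx ->]; rewrite andbT.
    by rewrite (le_trans _ asx) // lerDl ltW.
rewrite (@itv_bndbnd_setU _ _ (BLeft a) (BRight b) (BRight (b + s)%R)); last 2 first.
- by rewrite bnd_simp ltW.
- by rewrite bnd_simp lerDl ltW.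
rewrite ge0_integral_setU //; first last.
- apply/disj_setPS => y [/=]; rewrite 2!in_itv/= => /andP[_ yb] /andP[].
  by move=> /(le_lt_trans yb); rewrite ltxx.
- by move=> x _; rewrite lee_fin.
- exact: measurable_funTS.
apply: leeD2l; apply: le_trans (integral_le_measure (measurable_itv _)) _.
by rewrite lebesgue_measure_itv/= lte_fin ltrDl s0 -EFinB addrAC subrr add0r.
Qed.

Lemma integral_ge_of_shift_sum (c : R) :
  (0 <= c)%R -> (forall x, c <= h x + h (x + s))%R ->
  ((c * (b - a) - s) / 2)%:E <= \int[mu]_(x in `[a, b]) (h x)%:E.
Proof.
move=> c0 c_le.
have mhE : measurable_fun `[a, b] (fun x => (h x)%:E).
  exact/measurable_funTS/measurable_EFinP.
have mhsE : measurable_fun `[a, b] (fun x => (h (x + s))%:E).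
  exact/measurable_funTS/measurable_EFinP/(measurableT_comp mh)/measurable_funD.
have [r Ir] : exists r, \int[mu]_(x in `[a, b]) (h x)%:E = r%:E.
  exists (fine (\int[mu]_(x in `[a, b]) (h x)%:E)); rewrite fineK // ge0_fin_numE.
    apply: le_lt_trans (integral_le_measure (measurable_itv _)) _.
    by rewrite lebesgue_measure_itv /= lte_fin ab ltry.
  by apply: integral_ge0 => x _; rewrite lee_fin.
have sum_ge : (c * (b - a))%:E <= \int[mu]_(x in `[a, b]) (h x + h (x + s))%:E.
  by rewrite -integral_cst_itv //; apply: ge0_le_integral_nonmeasurable => x _;
    rewrite lee_fin.
move: sum_ge; under eq_integral do rewrite EFinD.
rewrite ge0_integralD //; last 2 first.
- by move=> x _; rewrite lee_fin.
- by move=> x _; rewrite lee_fin.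
move/le_trans/(_ (leeD2l _ integral_itv_addr_le)); rewrite Ir -!EFinD !lee_fin.
by move=> ?; lra.
Qed.

End shift_sum_integral.

Section cos_phase_integral.
Context {R : realType}.

Lemma cos_phase_integral_ge (p K lam tau a b : R) (g : R -> R) :
  0 <= p -> 0 < K -> 0 < lam -> 0 <= tau -> a < b ->
  (forall x y, `|g x - g y| <= K * `|x - y|) ->
  tau * K * pi <= 3 / 5 -> pi / lam <= 2^-1 `^ p * (b - a) ->
  ((2^-1 `^ p * (b - a) / 4)%:E <=
   \int[lebesgue_measure]_(t in `[a, b]) (`|cos (lam * (t - tau * g t))| `^ p)%:E)%E.
Proof.
move=> p0 K0 lam0 tau0 ab g_lip phase_small period_small.
set c := 2^-1 `^ p; set s := pi / (2 * lam).
set th := fun t => lam * (t - tau * g t); set u := fun t => `|cos (th t)|.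
have s0 : 0 < s by rewrite divr_gt0 ?pi_gt0 ?mulr_gt0.
have u_lip x y : `|u x - u y| <= lam * (1 + tau * K) * `|x - y|.
  apply: le_trans (ler_dist_dist _ _) _; apply: le_trans (ler_dist_cos _ _) _.
  rewrite (_ : th x - th y = lam * ((x - y) - tau * (g x - g y))); last by rewrite /th; ring.
  rewrite normrM gtr0_norm // -mulrA ler_pM2l //; apply: le_trans (ler_normB _ _) _.
  by rewrite normrM ger0_norm // mulrDl mul1r lerD2l -mulrA ler_wpM2l.
have mh : measurable_fun [set: R] (fun t => u t `^ p).
  apply: measurableT_comp (@measurable_powR R p) (continuous_measurable_fun _).
  by apply: lipschitz_continuous u_lip; rewrite !mulr_gt0 // ltr_pwDl // mulr_ge0 // ltW.
have h01 t : 0 <= u t `^ p <= 1.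
  rewrite powR_ge0 /=; apply: (@le_trans _ _ (1 `^ p)); last by rewrite powR1.
  by apply: ge0_ler_powR; rewrite ?nnegrE /u ?normr_ge0 ?cos_max.
have c_le x : c <= u x `^ p + u (x + s) `^ p.
  rewrite /u; have -> : th (x + s) = th x + pi / 2 + - (lam * tau * (g (x + s) - g x)).
    by rewrite /th /s; field; rewrite gt_eqF.
  apply: powR_norm_cos_quarter_turn_ge => //.
  rewrite normrN normrM ger0_norm; last by rewrite mulr_ge0 // ltW.
  apply: le_trans (ler_wpM2l _ (g_lip _ _)) _; first by rewrite mulr_ge0 // ltW.
  rewrite addrAC subrr add0r gtr0_norm // /s.
  rewrite (_ : lam * tau * (K * (pi / (2 * lam))) = tau * K * pi / 2); first lra.
  by field; rewrite gt_eqF.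
apply: le_trans (integral_ge_of_shift_sum mh h01 ab s0 (powR_ge0 _ _) c_le).
rewrite lee_fin /s; move: period_small; rewrite -/c invfM mulrCA => ?; lra.
Qed.

End cos_phase_integral.

Section cube_norm.
Context {R : realType}.
Local Notation mu := (@lebesgue_measure R).

Lemma cube_int_ge (k : nat) (a b m : R) (G : (nat -> R) -> \bar R) :
  a < b -> 0 <= m ->
  (forall x, m%:E <= \int[mu]_(t in `[a, b]) G (fun i => if i == 0%N then t else x i))%E ->
  ((m * (b - a) ^+ k)%:E <= cube_int k.+1 a b G)%E.
Proof.
move=> ab m0; elim: k G => [|k IH] G HG; first by rewrite expr0 mulr1; exact: HG.
rewrite [cube_int _ _ _ _]/= -[in X in (_ <= X)%E]/(cube_int _ _ _ _).
have -> : (m * (b - a) ^+ k.+1)%:E = (\int[mu]_(t in `[a, b]) (m * (b - a) ^+ k)%:E)%E.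
  by rewrite integral_cst_itv // exprS; congr EFin; ring.
apply: ge0_le_integral_nonmeasurable => [t _|t _].
  by rewrite lee_fin mulr_ge0 // exprn_ge0 // subr_ge0 ltW.
apply: (IH (fun x => G (fun i => if i == k.+1 then t else x i))) => x.
have := HG (fun i => if i == k.+1 then t else x i).
congr (_ <= _)%E; apply: eq_integral => t' _; congr G; apply/funext => i.
by case: eqP => [->|].
Qed.

Lemma Lp_norm_cube_ge (d : nat) (p L m : R) (g : (nat -> R) -> R) :
  0 < p -> 0 < L -> 0 <= m ->
  (forall x, (m%:E <= \int[mu]_(t in `[0%R, L])
     (`|g (fun i => if i == 0%N then t else x i)| `^ p)%:E)%E) ->
  (((m * L ^+ d) `^ p^-1)%:E <= Lp_norm_cube d.+1 p L g)%E.
Proof.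
move=> p0 L0 m0 slice_ge; rewrite /Lp_norm_cube -poweR_EFin.
have := cube_int_ge d (G := fun x => (`|g x| `^ p)%:E) L0 m0 slice_ge.
rewrite subr0 => cube_ge.
have vol_ge0 : (0 <= (m * L ^+ d)%:E)%E by rewrite lee_fin mulr_ge0 // exprn_ge0 // ltW.
have cube_ge0 := le_trans vol_ge0 cube_ge.
by apply: gt0_ler_poweR cube_ge; rewrite ?in_itv /= ?leey ?andbT // invr_ge0 ltW.
Qed.

Lemma W1inf_lipschitz (d : nat) (f : 'rV[R]_d -> R) : W1inf f ->
  exists2 K, 0 < K & forall x y, `|f x - f y| <= K * `|x - y|.
Proof.
move=> [_ [K f_lip]]; exists (`|K| + 1); first by rewrite ltr_pwDr.
move=> x y; apply: le_trans (f_lip x y) _; rewrite ler_wpM2r //.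
by rewrite (le_trans (ler_norm K)) // lerDl.
Qed.

Lemma lipschitz_slice0 (d : nat) (f : 'rV[R]_d -> R) (K : R) (x : nat -> R) :
  0 <= K -> (forall y z, `|f y - f z| <= K * `|y - z|) -> forall t t',
  `|f (vec d (fun i => if i == 0%N then t else x i)) -
    f (vec d (fun i => if i == 0%N then t' else x i))| <= K * `|t - t'|.
Proof.
move=> K0 f_lip t t'; apply: le_trans (f_lip _ _) (ler_wpM2l K0 _).
rewrite [leLHS]/Num.norm /= mx_normrE; apply: bigmax_le => [|[i j] _ /=].
  exact: normr_ge0.
by rewrite !mxE; case: ifP => _ //; rewrite subrr normr0.
Qed.

End cube_norm.

Section parameters.
Context {R : realType}.

Lemma lambda_seq_gt0 (n : nat) : 0 < lambda_seq n :> R.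
Proof. by rewrite mulr_gt0 // exprn_gt0. Qed.

Lemma t_seq_ge0 (n : nat) : 0 <= t_seq n :> R.
Proof. by rewrite divr_ge0 ?exprn_ge0 // !mulr_ge0 // ltW // pi_gt0. Qed.

Lemma pi_div_lambda_seq_le (p : R) (n : nat) : 0 <= p <= n%:R ->
  pi / lambda_seq n <= 2^-1 `^ p * pi.
Proof.
move=> /andP[p0 pn]; have pi0 := @pi_gt0 R.
have half01 : 0 < (2^-1 : R) <= 1 by apply/andP; split; lra.
have := ger_powR half01 pn.
rewrite powR_mulrn ?invr_ge0 // exprVn => pow_le.
rewrite /lambda_seq (_ : pi / _ = 8 / 11 * 2 ^- n * pi); last first.
  by field; rewrite gt_eqF // exprn_gt0.
rewrite ler_pM2r //.
have : 0 < 2 ^- n :> R by rewrite invr_gt0 exprn_gt0.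
lra.
Qed.

Lemma t_seq_phase_le (K : R) (n : nat) : 0 < K -> (4 <= n)%N -> 20 * K < n%:R ->
  t_seq n * K * pi <= 3 / 5.
Proof.
move=> K0 n4 nK; have pi0 := @pi_gt0 R; have pi4 : pi <= 4 :> R := pi_le4.
have pow_gt0 : 0 < 2 ^+ n :> R by rewrite exprn_gt0.
have sqr_le : n%:R * n%:R <= 2 ^+ n :> R.
  by rewrite -natrM -natrX ler_nat leq_sqr_exp2.
have -> : t_seq n * K * pi = 8 / 11 * (pi * pi) * (K * n%:R) / 2 ^+ n.
  by rewrite /t_seq; field; rewrite gt_eqF.
rewrite ler_pdivrMr //.
have : 20 * (K * n%:R) <= n%:R * n%:R by rewrite mulrA ler_wpM2r // ltW.
have : pi * pi <= 16 :> R by have := ler_pM (ltW pi0) (ltW pi0) pi4 pi4; lra.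
have : 0 <= K * n%:R by rewrite mulr_ge0 // ltW.
nra.
Qed.

Lemma two_powR_le_slice_bound (d : nat) (p : R) : 1 <= p ->
  2 `^ (- (d.+1%:R / p) - 2) <= (2^-1 `^ p * pi / 4 * pi ^+ d) `^ p^-1.
Proof.
move=> p1; have p0 : 0 < p by rewrite (lt_le_trans _ p1).
have pi0 := pi_gt0 R.
set a := 2 `^ p; set b : R := 2 ^+ d.+1.
have a2 : 2 <= a by rewrite /a -[leLHS]powRr1 // ler_powR // ler1n.
have b2 : 2 <= b by rewrite /b ler_eXnr // ler1n.
have pi_pow : 1 <= pi ^+ d.+1 :> R by rewrite exprn_ege1 // (le_trans _ (pi_ge2 R)) // ler1n.
have -> : 2 `^ (- (d.+1%:R / p) - 2) = (2 `^ (- d.+1%:R - 2 * p)) `^ p^-1 :> R.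
  by rewrite -powRrM; congr (_ `^ _); field; rewrite gt_eqF.
apply: ge0_ler_powR; rewrite ?nnegrE ?invr_ge0 ?powR_ge0 ?(ltW p0) //.
  by rewrite !mulr_ge0 ?exprn_ge0 ?powR_ge0 // ltW.
rewrite powRB ?pnatr_eq0 ?implybT // powRN powR_mulrn // (mulrC 2 p) powRrM -/a powR_mulrn ?powR_ge0 //.
rewrite powRV // -/a -/b.
have a0 : 0 < a by rewrite (lt_le_trans _ a2).
have b0 : 0 < b by rewrite (lt_le_trans _ b2).
rewrite (_ : b^-1 / a ^+ 2 = a^-1 * (1 / (a * b))); last by field; rewrite !gt_eqF.
rewrite (_ : a^-1 * pi / 4 * pi ^+ d = a^-1 * (pi ^+ d.+1 / 4)); last first.
  by rewrite exprS; ring.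
rewrite ler_pM2l ?invr_gt0 // ler_pdivrMr ?mulr_gt0 //.
have : 4 <= a * b by have := ler_pM _ _ a2 b2; rewrite (_ : 2 * 2 = 4 :> R) //; lra.
nra.
Qed.

End parameters.

Theorem lemma3p5 (R : realType) (d : nat) (p : R) (f : 'rV[R]_d -> R) :
  (2 <= d)%N -> 1 <= p -> W1inf f ->
  exists N0 : nat, (0 < N0)%N /\
    exists n0 : nat, forall n : nat, (n0 <= n)%N ->
      (((2 : R) `^ (- (d%:R / p) * N0%:R - 2))%:E <=
       Lp_norm_cube d p (2 * pi / 2 ^+ N0)
         (fun x => cos (lambda_seq n * (x 0%N - t_seq n * f (vec d x)))))%E.
Proof.
move=> d2 p1 /W1inf_lipschitz[K K0 f_lip].
have p0 : 0 < p by rewrite (lt_le_trans _ p1).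
case: d d2 f f_lip => [//|d] _ f f_lip.
exists 1%N; split => //.
exists (maxn (maxn 4 (Num.bound (20 * K))) (Num.bound p)) => n.
rewrite !geq_max => /andP[/andP[n4 nK] np].
have nK' : 20 * K < n%:R.
  by rewrite (lt_le_trans (archi_boundP _)) ?ler_nat // mulr_ge0 // ltW.
have np' : p <= n%:R.
  by rewrite ltW // (lt_le_trans (archi_boundP _)) ?ler_nat // ltW.
rewrite expr1 mulrAC divff ?pnatr_eq0 // mul1r mulr1.
apply: le_trans (Lp_norm_cube_ge d (m := 2^-1 `^ p * pi / 4) p0 (pi_gt0 R) _ _).
- by rewrite lee_fin two_powR_le_slice_bound.
- by rewrite !mulr_ge0 ?powR_ge0 // ltW // pi_gt0.
move=> x /=.
have := @cos_phase_integral_ge _ p K (lambda_seq n) (t_seq n) 0 pi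
  (fun t => f (vec d.+1 (fun i => if i == 0%N then t else x i))).
rewrite subr0; apply=> //.
- exact: ltW.
- exact: lambda_seq_gt0.
- exact: t_seq_ge0.
- exact: pi_gt0.
- exact: lipschitz_slice0 (ltW K0) f_lip.
- exact: t_seq_phase_le.
- by rewrite pi_div_lambda_seq_le // ltW.
Qed.
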